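(* Let $q\ge2$. If $K$ is a $q$-periodic virtual knot diagram, then $\bar K=P_f^\infty(K)$, the image of $K$ under stable Manturov projection with respect to the total Gaussian parity $f$, is a $q$-periodic almost classical diagram.
   Context: A virtual knot diagram is an immersed oriented circle in the plane with transverse double points marked classical (with over/under information) or virtual. It is $q$-periodic if it misses the origin and is invariant under rotation of the plane by $2\pi/q$ about the origin. The Gauss diagram of a virtual knot diagram is a counterclockwise oriented circle with one directed signed chord for each classical crossing, joining the two preimages of the crossing, pointing from the over-crossing point to the under-crossing point, with sign $\varepsilon=\pm1$ equal to the sign of the crossing. The index of a chord $c$ is $I(c)=r_+-r_-+\ell_--\ell_+$, where, with the diagram positioned so that $c$ points vertically upward, $r_\pm$ (resp. $\ell_\pm$) is the number of chords of sign $\pm1$ that intersect $c$ and have their arrowhead to the right (resp. left) of $c$. The total Gaussian parity is $f(c)=0$ (even) if $I(c)=0$ and $f(c)=1$ (odd) if $I(c)\ne0$. Manturov projection $P_f$ removes all odd chords from the Gauss diagram; on the level of virtual knot diagrams, it replaces every odd classical crossing by a virtual crossing. Since there are finitely many chords, for each diagram $D$ there is $n$ with $P_f^{n+1}(D)=P_f^n(D)$; $P_f^\infty(D)$ denotes this stable diagram $P_f^n(D)$. A virtual knot diagram is almost classical if it admits an Alexander numbering, i.e. an integer-valued function on its short arcs (arcs between consecutive classical crossing points) such that at each classical crossing, drawn with both strands oriented downwards, the two left-hand arcs have a common number $\lambda$ and the two right-hand arcs have number $\lambda+1$ (numbers are unchanged through virtual crossings). Equivalently, every chord of its Gauss diagram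 has index $0$. *)

(* Defs.v *)
From HB Require Import structures.
From mathcomp Require Import all_boot all_order all_algebra finmap.
From mathcomp Require Import all_classical all_reals all_analysis.

Set Implicit Arguments.
Unset Strict Implicit.
Unset Printing Implicit Defensive.

Import Order.TTheory GRing.Theory Num.Theory.
Import numFieldNormedType.Exports.

Local Open Scope classical_set_scope.
Local Open Scope fset_scope.
Local Open Scope ring_scope.

(** The circle is R/Z. Maps defined on it are 1-periodic maps on R, and a point
    of it is represented by its unique representative in [0, 1). *)

Definition frac_part (R : realType) (t : R) : R := t - (Num.floor t)%:~R.

Definition smooth (R : realType) (f : R -> R) : Prop :=
  forall (n : nat) (t : R), derivable (derive1n n f) t 1.

Definition velocity (R : realType) (g : R -> R * R) (t : R) : R * R :=
  (derive1 (fst \o g) t, derive1 (snd \o g) t).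

Definition det2 (R : realType) (v w : R * R) : R := v.1 * w.2 - v.2 * w.1.

Definition rotation (R : realType) (theta : R) (p : R * R) : R * R :=
  (cos theta * p.1 - sin theta * p.2, sin theta * p.1 + cos theta * p.2).

(** Immersed oriented circles whose only multiple points are transverse double
    points. There are automatically finitely many of them, by compactness. *)
Record immersed_circle (R : realType) := ImmersedCircle {
  curve :> R -> R * R;
  curve_periodic : forall t, curve (t + 1) = curve t;
  curve_smooth : smooth (fst \o curve) /\ smooth (snd \o curve);
  curve_immersion : forall t, velocity curve t <> (0, 0);
  curve_no_triple : forall r s t, 0 <= r -> r < s -> s < t -> t < 1 ->
    ~ (curve r = curve s /\ curve s = curve t);
  curve_transverse : forall s t, 0 <= s -> s < t -> t < 1 ->
    curve s = curve t -> det2 (velocity curve s) (velocity curve t) != 0 }.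

(** A classical crossing is recorded as the pair (over-crossing parameter,
    under-crossing parameter), both in [0, 1). The double points that are not
    recorded in [crossings] are the virtual crossings. *)
Definition crossing_info (R : realType) (g : R -> R * R)
    (C : {fset R * R}) : Prop :=
  forall c, c \in C ->
    [/\ 0 <= c.1 < 1, 0 <= c.2 < 1, c.1 != c.2, g c.1 = g c.2
      & (c.2, c.1) \notin C].

Record virtual_knot_diagram (R : realType) := VirtualKnotDiagram {
  underlying_curve : immersed_circle R;
  crossings : {fset R * R};
  crossingsP : crossing_info underlying_curve crossings }.

(** [s] and [t] are parameters in R of the over- and under-strand of a classical
    crossing. *)
Definition classical_crossing (R : realType) (D : virtual_knot_diagram R)
    (s t : R) : Prop := (frac_part s, frac_part t) \in crossings D.

(** Orientation-preserving diffeomorphisms of R/Z, lifted to R. *)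
Definition circle_diffeo (R : realType) (phi : R -> R) : Prop :=
  [/\ smooth phi, forall t, 0 < derive1 phi t
    & forall t, phi (t + 1) = phi t + 1].

(** Equality of a diagram with its rotated image, as oriented immersed circles
    with marked double points: the two parametrizations differ by an
    orientation-preserving reparametrization that matches the over- and
    under-strands of the classical crossings. *)
Definition rotation_invariant (R : realType) (theta : R)
    (D : virtual_knot_diagram R) : Prop :=
  exists phi : R -> R,
    [/\ circle_diffeo phi,
        forall t, rotation theta (underlying_curve D t)
                  = underlying_curve D (phi t)
      & forall s t, classical_crossing D s t
                    <-> classical_crossing D (phi s) (phi t)].

Definition periodic_diagram (R : realType) (q : nat)
    (D : virtual_knot_diagram R) : Prop :=
  (forall t, underlying_curve D t <> (0, 0))
  /\ rotation_invariant (2 * pi / q%:R) D.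

(** Gauss diagrams: a chord is (tail, head, sign), with tail and head in [0, 1)
    read as points of the counterclockwise oriented circle R/Z. *)

Notation chord R := (R * R * int)%type.
Definition chord_tail (R : realType) (c : chord R) : R := c.1.1.
Definition chord_head (R : realType) (c : chord R) : R := c.1.2.
Definition chord_sign (R : realType) (c : chord R) : int := c.2.

(** [x] is on the open arc running counterclockwise from [a] to [b]. *)
Definition in_arc (R : realType) (a b x : R) : bool :=
  [|| a < x < b, x < b < a | b < a < x].

(** When [c] points upward, its right side is the arc running counterclockwise
    from its tail to its head. *)
Definition head_right (R : realType) (c d : chord R) : bool :=
  in_arc (chord_tail c) (chord_head c) (chord_head d)
  && in_arc (chord_head c) (chord_tail c) (chord_tail d).

Definition head_left (R : realType) (c d : chord R) : bool :=
  in_arc (chord_head c) (chord_tail c) (chord_head d)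
  && in_arc (chord_tail c) (chord_head c) (chord_tail d).

Definition n_right (R : realType) (G : {fset chord R}) (c : chord R)
    (e : int) : nat :=
  #|` [fset d in G | head_right c d && (chord_sign d == e)]|.

Definition n_left (R : realType) (G : {fset chord R}) (c : chord R)
    (e : int) : nat :=
  #|` [fset d in G | head_left c d && (chord_sign d == e)]|.

Definition chord_index (R : realType) (G : {fset chord R}) (c : chord R)
    : int :=
  (n_right G c 1)%:Z - (n_right G c (-1))%:Z
  + (n_left G c (-1))%:Z - (n_left G c 1)%:Z.

Definition odd_chord (R : realType) (G : {fset chord R}) (c : chord R)
    : bool := chord_index G c != 0.

(** A crossing is positive when its over-strand turns counterclockwise, by an
    angle less than pi, onto its under-strand. *)
Definition crossing_sign (R : realType) (D : virtual_knot_diagram R)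
    (c : R * R) : int :=
  sgz (det2 (velocity (underlying_curve D) c.1)
            (velocity (underlying_curve D) c.2)).

Definition crossing_chord (R : realType) (D : virtual_knot_diagram R)
    (c : R * R) : chord R := (c, crossing_sign D c).

Definition gauss_diagram (R : realType) (D : virtual_knot_diagram R)
    : {fset chord R} :=
  [fset crossing_chord D c | c in crossings D].

Definition even_crossings (R : realType) (D : virtual_knot_diagram R)
    : {fset R * R} :=
  [fset c in crossings D | ~~ odd_chord (gauss_diagram D) (crossing_chord D c)].

Lemma even_crossingsP (R : realType) (D : virtual_knot_diagram R) :
  crossing_info (underlying_curve D) (even_crossings D).
Proof.
move=> c /imfsetP[d]; rewrite inE /= => /andP[dD _] ->.
have [h1 h2 h3 h4 h5] := crossingsP dD; split=> //.
apply/imfsetP => -[e]; rewrite inE /= => /andP[eD _] ee.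
by rewrite ee eD in h5.
Qed.

Definition manturov_projection (R : realType) (D : virtual_knot_diagram R)
    : virtual_knot_diagram R :=
  VirtualKnotDiagram (@even_crossingsP R D).

Lemma manturov_projection_stabilizes (R : realType)
    (D : virtual_knot_diagram R) :
  exists n, iter n.+1 (@manturov_projection R) D
            = iter n (@manturov_projection R) D.
Proof.
have [m] := ubnP #|` crossings D|; elim: m D => // m IHm D.
rewrite ltnS => leDm.
have sub : even_crossings D `<=` crossings D.
  by apply/fsubsetP => c /imfsetP[d]; rewrite inE /= => /andP[dD _] ->.
have [eqE | neqE] := eqVneq (even_crossings D) (crossings D).
  exists 0%N; rewrite /= /manturov_projection.
  move: (even_crossings D) (@even_crossingsP R D) eqE => C' CP'.
  case: D {leDm sub} CP' => g C CP /= CP' eqC; case: _ / eqC CP => CP.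
  by congr VirtualKnotDiagram; exact: Prop_irrelevance.
have [|n En] := IHm (manturov_projection D).
  apply: leq_trans leDm; apply: fproper_ltn_card.
  by rewrite fproperEneq neqE.
by exists n.+1; rewrite iterSr En -iterSr.
Qed.

Definition stable_projection (R : realType) (D : virtual_knot_diagram R)
    : virtual_knot_diagram R :=
  iter (projT1 (cid (manturov_projection_stabilizes D)))
    (@manturov_projection R) D.

Definition classical_point (R : realType) (D : virtual_knot_diagram R) (t : R)
    : Prop :=
  exists s, classical_crossing D s t \/ classical_crossing D t s.

(** A labelling of the short arcs is a 1-periodic function of the parameter that
    is constant between classical crossing points; its values at those points
    are irrelevant. When both strands of a crossing are drawn downwards, the
    strand [a] with [det2 (velocity a) (velocity b) < 0] runs from upper left to
    lower right, and the other strand [b] from upper right to lower left. *)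
Definition alexander_numbering (R : realType) (D : virtual_knot_diagram R)
    (N : R -> int) : Prop :=
  [/\ forall t, N (t + 1) = N t,
      forall s t, s <= t -> (forall r, s <= r <= t -> ~ classical_point D r) ->
        N s = N t
    & forall a b, classical_crossing D a b \/ classical_crossing D b a ->
        det2 (velocity (underlying_curve D) a)
             (velocity (underlying_curve D) b) < 0 ->
        exists lam : int,
          [/\ \forall t \near a^'-, N t = lam,
              \forall t \near b^'+, N t = lam,
              \forall t \near a^'+, N t = lam + 1
            & \forall t \near b^'-, N t = lam + 1]].

Definition almost_classical (R : realType) (D : virtual_knot_diagram R)
    : Prop :=
  exists N : R -> int, alexander_numbering D N.

(* Main.v *)
Require Import Defs.
From mathcomp Require Import all_boot all_order all_algebra.
From mathcomp Require Import all_classical all_reals all_analysis.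
From mathcomp Require Import finmap lra ring zify.

(** A rotation of the plane preserving [K] acts on the parameter circle by an
    orientation-preserving diffeomorphism, hence preserves the cyclic order of
    the crossing points; it also preserves crossing signs, since the velocities
    are rotated and rescaled by positive factors. So it preserves indices, and
    each projection step removes a rotation-invariant set of crossings.

    A stable diagram has only chords of index 0. Label the circle by a step
    function that jumps by [e] at the under-crossing point and by [- e] at the
    over-crossing point of every crossing of sign [e]. Between the two endpoints
    of a chord the total jump is the index of the chord, and it vanishes: this
    is the Alexander condition at the crossing. *)

Set Implicit Arguments.
Unset Strict Implicit.
Unset Printing Implicit Defensive.

Import Order.TTheory GRing.Theory Num.Theory.
Import numFieldNormedType.Exports.

Local Open Scope classical_set_scope.
Local Open Scope fset_scope.
Local Open Scope ring_scope.

(** * Fractional parts, periodic functions and the planar determinant *)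

Lemma frac_part_itv (R : realType) (t : R) : 0 <= frac_part t < 1.
Proof.
by have := floor_itv t; rewrite intrD /frac_part => ?; lra.
Qed.

Lemma frac_part_id (R : realType) (t : R) : 0 <= t < 1 -> frac_part t = t.
Proof.
by move=> t01; rewrite /frac_part (@floor_def _ _ 0) ?subr0// add0r.
Qed.

Lemma periodicDint (R : realType) (T : Type) (f : R -> T) :
  (forall t, f (t + 1) = f t) -> forall t (m : int), f (t + m%:~R) = f t.
Proof.
move=> f1; have fn t (n : nat) : f (t + n%:R) = f t.
  elim: n => [|n IHn]; first by rewrite addr0.
  by rewrite -natr1 addrA f1.
move=> t [n|n]; first exact: fn.
by rewrite NegzE mulrNz -[in RHS](subrK (n.+1%:~R) t) fn.
Qed.

Lemma periodic_frac_part (R : realType) (T : Type) (f : R -> T) :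
  (forall t, f (t + 1) = f t) -> forall t, f (frac_part t) = f t.
Proof.
by move=> f1 t; rewrite /frac_part -mulrNz (periodicDint f1).
Qed.

Lemma frac_part_periodic (R : realType) (t : R) :
  frac_part (t + 1) = frac_part t.
Proof.
by rewrite /frac_part floorDrz ?rpred1 // floor1 intrD; ring.
Qed.

Lemma derive1_periodic (R : realType) (f : R -> R) :
  (forall t, f (t + 1) = f t) -> forall t, derive1 f (t + 1) = derive1 f t.
Proof.
by move=> f1 t; rewrite /derive1; under eq_fun do rewrite addrA !f1.
Qed.

Lemma velocity_periodic (R : realType) (g : immersed_circle R) t :
  velocity g (t + 1) = velocity g t.
Proof.
by congr (_, _); apply: derive1_periodic => s /=; rewrite curve_periodic.
Qed.

Lemma velocity_frac_part (R : realType) (g : immersed_circle R) t :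
  velocity g (frac_part t) = velocity g t.
Proof. exact: (periodic_frac_part (@velocity_periodic R g)). Qed.

Lemma det2C (R : realType) (v w : R * R) : det2 v w = - det2 w v.
Proof. rewrite /det2; ring. Qed.

Lemma det2_rotation (R : realType) (theta : R) v w :
  det2 (rotation theta v) (rotation theta w) = det2 v w.
Proof.
rewrite /det2 /rotation /=.
transitivity ((cos theta ^+ 2 + sin theta ^+ 2) * (v.1 * w.2 - v.2 * w.1)).
  by ring.
by rewrite cos2Dsin2 mul1r.
Qed.

(** * Circle diffeomorphisms and the cyclic order *)

Lemma circle_diffeo_derivable (R : realType) (phi : R -> R) :
  circle_diffeo phi -> forall t, derivable phi t 1.
Proof. by case=> sm _ _ t; exact: (sm 0%N). Qed.

Lemma circle_diffeo_le (R : realType) (phi : R -> R) :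
  circle_diffeo phi -> {mono phi : x y / x <= y}.
Proof.
move=> dphi; apply/le_mono => x y xy.
have drv := circle_diffeo_derivable dphi; case: dphi => _ pos _.
apply: (@gtr0_derive1_lt_cc _ _ x y); rewrite ?in_itv /= ?lexx ?ltW //.
by apply: derivable_within_continuous => t _; exact: drv.
Qed.

Lemma circle_diffeo_lt (R : realType) (phi : R -> R) :
  circle_diffeo phi -> {mono phi : x y / x < y}.
Proof. by move=> dphi; exact/leW_mono/circle_diffeo_le. Qed.

(** The lift sends [0, 1) into the unit interval starting at [phi 0], which contains at most one
    integer besides its starting point; reduction mod 1 thus leaves two cases. *)
Lemma frac_part_circle_diffeo (R : realType) (phi : R -> R) (y : R) :
  circle_diffeo phi -> 0 <= y < 1 ->
  [/\ phi 0 <= phi y < phi 0 + 1, 0 <= frac_part (phi y) < 1 &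
      frac_part (phi y) = phi y - (Num.floor (phi 0))%:~R \/
      frac_part (phi y) = phi y - (Num.floor (phi 0))%:~R - 1].
Proof.
move=> dphi y01.
have phiy : phi 0 <= phi y < phi 0 + 1.
  have mon := circle_diffeo_lt dphi; case: (dphi) => _ _ per.
  by rewrite -per mon circle_diffeo_le // add0r.
split=> //; first exact: frac_part_itv.
have := floor_itv (phi 0); have := floor_itv (phi y); rewrite /frac_part.
set k := Num.floor (phi 0); set l := Num.floor (phi y) => hl hk.
have : l = k \/ l = k + 1.
  have : (k%:~R : R) < (l + 1)%:~R by lra.
  have : (l%:~R : R) < (k + 1 + 1)%:~R by rewrite intrD; lra.
  by rewrite !ltr_int; lia.
by case=> ->; [left | right; rewrite intrD; ring].
Qed.

Lemma in_arc_circle_diffeo (R : realType) (phi : R -> R) (a b x : R) :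
  circle_diffeo phi -> 0 <= a < 1 -> 0 <= b < 1 -> 0 <= x < 1 ->
  in_arc (frac_part (phi a)) (frac_part (phi b)) (frac_part (phi x))
  = in_arc a b x.
Proof.
move=> dphi a01 b01 x01.
have [Pa pa ea] := frac_part_circle_diffeo dphi a01.
have [Pb pb eb] := frac_part_circle_diffeo dphi b01.
have [Px px ex] := frac_part_circle_diffeo dphi x01.
have mon := circle_diffeo_lt dphi.
rewrite /in_arc -(mon a x) -(mon x b) -(mon b a).
move: ea eb ex pa pb px Pa Pb Px.
move: (frac_part _) (frac_part _) (frac_part _) => p q r.
move: (phi 0) (phi a) (phi b) (phi x) => z P Q X {mon}.
(* Eight cases, by which of the three points wrap around; each is linear arithmetic on the lifts. *)
by move=> [->|->] [->|->] [->|->] *; apply/idP/idP => H; lra.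
Qed.

Lemma frac_part_circle_diffeo_inj (R : realType) (phi : R -> R) (s t : R) :
  circle_diffeo phi -> 0 <= s < 1 -> 0 <= t < 1 ->
  frac_part (phi s) = frac_part (phi t) -> s = t.
Proof.
move=> dphi s01 t01 e.
have [Ps _ es] := frac_part_circle_diffeo dphi s01.
have [Pt _ et] := frac_part_circle_diffeo dphi t01.
have mon := circle_diffeo_lt dphi.
(* The lifts differ by 0, 1 or -1 and lie in one half-open unit interval. *)
have pst : phi s = phi t by lra.
by case: (ltgtP s t) => // st; [have := mon s t | have := mon t s];
  rewrite st pst ltxx.
Qed.

(** * Crossings and chord indices *)

(** Order-free form of [curve_no_triple]. *)
Lemma curve_no_three_params (R : realType) (g : immersed_circle R) (r s t : R) :
  0 <= r < 1 -> 0 <= s < 1 -> 0 <= t < 1 -> g r = g s -> g s = g t ->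
  [|| r == s, s == t | r == t].
Proof.
move=> /andP[r0 r1] /andP[s0 s1] /andP[t0 t1] grs gst.
have nt := @curve_no_triple R g.
case: (ltgtP r s) => //= rs; case: (ltgtP s t) => //= st;
  case: (ltgtP r t) => //= rt; exfalso.
all: try lra.
- by apply: (nt r s t).
- by apply: (nt r t s); rewrite // grs gst.
- by apply: (nt t r s); rewrite // grs gst.
- by apply: (nt s r t); rewrite // grs gst.
- by apply: (nt s t r); rewrite // grs gst.
- by apply: (nt t s r); rewrite // grs gst.
Qed.

(** A shared endpoint puts three parameters over one point, so the other endpoints agree too; the
    crossings then coincide or have exchanged strands, both excluded. *)
Lemma crossings_disjoint (R : realType) (D : virtual_knot_diagram R) c d :
  c \in crossings D -> d \in crossings D -> c != d ->
  [/\ c.1 != d.1, c.1 != d.2, c.2 != d.1 & c.2 != d.2].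
Proof.
case: c d => [ o u] [ o' u'] cD dD.
have [/= o01 u01 nou g1 nc] := crossingsP cD.
have [/= o01' u01' nou' g2 nd] := crossingsP dD.
rewrite xpair_eqE => ncd; split; apply/eqP => e; subst.
- have := curve_no_three_params u01 o01' u01' (esym g1) g2.
  rewrite eq_sym (negPf nou) (negPf nou') /= => /eqP e.
  by subst; rewrite !eqxx in ncd.
- have := curve_no_three_params u01 u01' o01' (esym g1) (esym g2).
  rewrite eq_sym (negPf nou) eq_sym (negPf nou') /= => /eqP e.
  by subst; rewrite cD in nd.
- have := curve_no_three_params o01 o01' u01' g1 g2.
  rewrite (negPf nou) (negPf nou') /= => /eqP e.
  by subst; rewrite cD in nd.
- have := curve_no_three_params o01 u01' o01' g1 (esym g2).
  rewrite (negPf nou) eq_sym (negPf nou') /= => /eqP e.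
  by subst; rewrite !eqxx in ncd.
Qed.

Lemma crossing_sign_or (R : realType) (D : virtual_knot_diagram R) c :
  c \in crossings D -> crossing_sign D c = 1 \/ crossing_sign D c = -1.
Proof.
case: c => [ o u] cD; rewrite /crossing_sign /=.
have [/= /andP[ o0 o1] /andP[u0 u1] nou g1 nc] := crossingsP cD.
set g := underlying_curve D in g1 *.
have : det2 (velocity g o) (velocity g u) != 0.
  case: (ltgtP o u) nou => // ou _; first exact: curve_transverse.
  by rewrite det2C oppr_eq0 curve_transverse.
by rewrite neq_lt => /orP[/ltr0_sgz->|/gtr0_sgz->]; [right | left].
Qed.

Lemma card_fset_filter (T : choiceType) (A : {fset T}) (P : pred T) :
  (#|` [fset d in A | P d]|)%:Z = \sum_(d <- A) (P d : nat)%:Z.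
Proof.
rewrite card_fset_sum1 -natz -big_fset_condE /= big_mkcond /= natr_sum.
by apply: eq_bigr => d _; case: (P d).
Qed.

(** Algebraic intersection number: 1 when [d] crosses [c] with its head on the right, -1 with its
    head on the left, 0 without crossing. *)
Definition arc_intersection (R : realType) (c d : R * R) : int :=
  (in_arc c.1 c.2 d.2 && in_arc c.2 c.1 d.1 : nat)%:Z
  - (in_arc c.2 c.1 d.2 && in_arc c.1 c.2 d.1 : nat)%:Z.

(** Since signs are 1 or -1, the four counts of the index merge into one sum over crossings, which a
    rotation can reindex. *)
Lemma chord_index_sum (R : realType) (D : virtual_knot_diagram R) c :
  chord_index (gauss_diagram D) (crossing_chord D c)
  = \sum_(d <- crossings D) crossing_sign D d * arc_intersection c d.
Proof.
rewrite /chord_index /n_right /n_left !card_fset_filter.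
rewrite -sumrB -big_split -sumrB /=.
rewrite /gauss_diagram big_imfset /=; last by move=> x y _ _ [].
rewrite big_seq_cond [RHS]big_seq_cond; apply: eq_bigr => d /andP[dD _].
rewrite /arc_intersection /head_right /head_left.
rewrite /chord_sign /chord_head /chord_tail /=.
by case: (crossing_sign_or dD) => -> /=; rewrite !andbT !andbF;
  case: (_ && _); case: (_ && _).
Qed.

Lemma mem_crossings_manturov (R : realType) (D : virtual_knot_diagram R) c :
  (c \in crossings (manturov_projection D))
  = (c \in crossings D)
    && (chord_index (gauss_diagram D) (crossing_chord D c) == 0).
Proof. by rewrite /= !inE /= /odd_chord negbK. Qed.

(** * Invariance under rotation *)

Definition circle_image (R : realType) (phi : R -> R) (c : R * R) : R * R :=
  (frac_part (phi c.1), frac_part (phi c.2)).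

(** An injective self-map of a finite set permutes it. *)
Lemma big_fset_inj_endo (T : choiceType) (A : {fset T}) (f : T -> T)
    (V : nmodType) (F : T -> V) :
  {in A &, injective f} -> {in A, forall x, f x \in A} ->
  \sum_(x <- A) F (f x) = \sum_(x <- A) F x.
Proof.
move=> finj fA.
have imA : [fset f x | x in A] = A.
  apply/eqP; rewrite eqEfcard card_in_imfset // leqnn andbT.
  by apply/fsubsetP => _ /imfsetP[x /= xA ->]; exact: fA.
by rewrite -[in RHS]imA big_imfset.
Qed.

Section rotation_invariance.
Variables (R : realType) (theta : R) (D : virtual_knot_diagram R).
Variable phi : R -> R.
Let g := underlying_curve D.
Hypotheses (dphi : circle_diffeo phi)
  (rphi : forall t, rotation theta (g t) = g (phi t))
  (cphi : forall s t,
    classical_crossing D s t <-> classical_crossing D (phi s) (phi t)).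

(** Differentiate [rphi]: the rotation is linear, and the chain rule gives the factor on the
    right. *)
Lemma velocity_circle_diffeo t :
  rotation theta (velocity g t)
  = (derive1 phi t * (velocity g (phi t)).1,
     derive1 phi t * (velocity g (phi t)).2).
Proof.
have [sm1 sm2] := curve_smooth g.
have d1 x : derivable (fst \o g) x 1 by exact: (sm1 0%N).
have d2 x : derivable (snd \o g) x 1 by exact: (sm2 0%N).
have dp := circle_diffeo_derivable dphi.
rewrite /velocity /= ![derive1 phi t * _]mulrC.
rewrite -(derive1_comp (dp t) (d1 _)) -(derive1_comp (dp t) (d2 _)).
have -> : (fst \o g) \o phi = cos theta *: (fst \o g) - sin theta *: (snd \o g).
  by apply/funext => x; rewrite /= -rphi.
have -> : (snd \o g) \o phi = sin theta *: (fst \o g) + cos theta *: (snd \o g).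
  by apply/funext => x; rewrite /= -rphi.
rewrite !derive1E deriveB ?deriveD; try exact: derivableZ.
by rewrite !deriveZ // /rotation /= !derive1E.
Qed.

Lemma crossing_sign_circle_image c :
  crossing_sign D (circle_image phi c) = crossing_sign D c.
Proof.
rewrite /crossing_sign /circle_image /= !velocity_frac_part -/g.
have [_ pos _] := dphi; have p1 := pos c.1; have p2 := pos c.2.
rewrite -(det2_rotation theta (velocity g c.1)) !velocity_circle_diffeo.
set v := velocity g _; set w := velocity g (phi c.2).
have -> : det2 (derive1 phi c.1 * v.1, derive1 phi c.1 * v.2)
   (derive1 phi c.2 * w.1, derive1 phi c.2 * w.2) =
   (derive1 phi c.1 * derive1 phi c.2) * det2 v w by rewrite /det2 /=; ring.
by rewrite !sgzM (gtr0_sgz p1) (gtr0_sgz p2) !mul1r.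
Qed.

Lemma circle_image_crossings c : 0 <= c.1 < 1 -> 0 <= c.2 < 1 ->
  (circle_image phi c \in crossings D) = (c \in crossings D).
Proof.
case: c => x y /= x01 y01; have := cphi x y.
rewrite /classical_crossing (frac_part_id x01) (frac_part_id y01) /circle_image /=.
by move=> h; apply/idP/idP => /h.
Qed.

Lemma chord_index_circle_image c : c \in crossings D ->
  chord_index (gauss_diagram D) (crossing_chord D (circle_image phi c))
  = chord_index (gauss_diagram D) (crossing_chord D c).
Proof.
move=> cD; rewrite !chord_index_sum; have [c1 c2 _ _ _] := crossingsP cD.
(* Reindex by [circle_image phi], which permutes the crossings; sign and intersection number then
   agree term by term. *)
rewrite -(@big_fset_inj_endo _ _ (circle_image phi)); first last.
- by move=> d dD; have [d1 d2 _ _ _] := crossingsP dD; rewrite circle_image_crossings.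
- move=> [x y] [x' y'] /crossingsP[/= x1 y1 _ _ _] /crossingsP[/= x1' y1' _ _ _].
  case=> /(frac_part_circle_diffeo_inj dphi x1 x1') ->.
  by move=> /(frac_part_circle_diffeo_inj dphi y1 y1') ->.
rewrite big_seq_cond [RHS]big_seq_cond; apply: eq_bigr => d /andP[dD _].
have [d1 d2 _ _ _] := crossingsP dD.
by rewrite crossing_sign_circle_image /arc_intersection /= !in_arc_circle_diffeo.
Qed.

Lemma circle_image_crossings_manturov c : 0 <= c.1 < 1 -> 0 <= c.2 < 1 ->
  (circle_image phi c \in crossings (manturov_projection D))
  = (c \in crossings (manturov_projection D)).
Proof.
move=> c1 c2; rewrite !mem_crossings_manturov (circle_image_crossings c1 c2).
by apply: andb_id2l => cD; rewrite (chord_index_circle_image cD).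
Qed.

Lemma manturov_projection_crossing s t :
  classical_crossing (manturov_projection D) s t <->
  classical_crossing (manturov_projection D) (phi s) (phi t).
Proof.
(* [phi] commutes with unit shifts, so it descends to the circle. *)
have fphi x : frac_part (phi (frac_part x)) = frac_part (phi x).
  apply: (@periodic_frac_part _ _ (fun x => frac_part (phi x))) => {}x.
  have [_ _ ->] := dphi.
  exact: frac_part_periodic.
have := @circle_image_crossings_manturov (frac_part s, frac_part t)
  (frac_part_itv s) (frac_part_itv t).
by rewrite /circle_image [(_, _).1]/= [(_, _).2]/= !fphi /classical_crossing => ->.
Qed.

End rotation_invariance.

(** The projection keeps the curve, so the same reparametrization [phi] still serves. *)
Lemma periodic_manturov_projection (R : realType) (q : nat)
    (D : virtual_knot_diagram R) :
  periodic_diagram q D -> periodic_diagram q (manturov_projection D).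
Proof.
case=> nz [phi [dphi rphi cphi]]; split=> //; exists phi; split=> //.
exact: manturov_projection_crossing rphi cphi.
Qed.

(** * Alexander numbering from vanishing indices *)

(** Each floor jumps by 1 at the lifts of one crossing point; the difference of the two floors is
    1-periodic. *)
Definition arc_label (R : realType) (D : virtual_knot_diagram R) (t : R) : int :=
  \sum_(d <- crossings D)
    crossing_sign D d * (Num.floor (t - d.2) - Num.floor (t - d.1)).

(** The left limit of [arc_label]: left limits of floors are ceilings minus 1, and the -1 cancels in
    each difference. *)
Definition left_arc_label (R : realType) (D : virtual_knot_diagram R) (t : R)
    : int :=
  \sum_(d <- crossings D)
    crossing_sign D d * (Num.ceil (t - d.2) - Num.ceil (t - d.1)).

Lemma floor_near_right (R : realType) (a u : R) :
  \forall t \near a^'+, Num.floor (t - u) = Num.floor (a - u).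
Proof.
have /andP[h1 h2] := floor_itv (a - u).
(* The bound on the right is the first jump of the floor after [a]. *)
have lt : a < u + (Num.floor (a - u) + 1)%:~R by lra.
near=> t; apply: floor_def.
have at_ : a < t by near: t; exact: nbhs_right_gt.
have tu : t < u + (Num.floor (a - u) + 1)%:~R by near: t; exact: nbhs_right_lt.
lra.
Unshelve. all: by end_near. Qed.

Lemma floor_near_left (R : realType) (a u : R) :
  \forall t \near a^'-, Num.floor (t - u) = Num.ceil (a - u) - 1.
Proof.
have /andP[h1 h2] := ceil_itv (a - u).
have lt : u + (Num.ceil (a - u) - 1)%:~R < a by lra.
near=> t; apply: floor_def; rewrite subrK.
have at_ : t < a by near: t; exact: nbhs_left_lt.
have tu : u + (Num.ceil (a - u) - 1)%:~R < t by near: t; exact: nbhs_left_gt.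
lra.
Unshelve. all: by end_near. Qed.

Lemma near_sum (T I : Type) (F : set_system T) (FF : Filter F) (s : seq I)
    (V : nmodType) (f : I -> T -> V) (l : I -> V) :
  (forall i, \forall t \near F, f i t = l i) ->
  \forall t \near F, \sum_(i <- s) f i t = \sum_(i <- s) l i.
Proof.
move=> fl; elim: s => [|i s IHs].
  by apply: nearW => t; rewrite !big_nil.
by apply: filterS2 (fl i) IHs => t e1 e2; rewrite !big_cons e1 e2.
Qed.

Lemma arc_label_near_right (R : realType) (D : virtual_knot_diagram R) (a : R) :
  \forall t \near a^'+, arc_label D t = arc_label D a.
Proof.
apply: near_sum => d.
have := @floor_near_right R a d.2; have := @floor_near_right R a d.1.
by apply: filterS2 => t -> ->.
Qed.

Lemma arc_label_near_left (R : realType) (D : virtual_knot_diagram R) (a : R) :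
  \forall t \near a^'-, arc_label D t = left_arc_label D a.
Proof.
apply: near_sum => d.
have := @floor_near_left R a d.2; have := @floor_near_left R a d.1.
by apply: filterS2 => t -> ->; congr (_ * _); ring.
Qed.

Lemma arc_label_periodic (R : realType) (D : virtual_knot_diagram R) (t : R) :
  arc_label D (t + 1) = arc_label D t.
Proof.
have fl x : Num.floor (t + 1 - x) = Num.floor (t - x) + 1.
  by rewrite addrAC floorDrz ?rpred1 // floor1.
by apply: eq_bigr => d _; rewrite !fl; congr (_ * _); ring.
Qed.

Lemma left_arc_label_periodic (R : realType) (D : virtual_knot_diagram R) (t : R) :
  left_arc_label D (t + 1) = left_arc_label D t.
Proof.
have cl x : Num.ceil (t + 1 - x) = Num.ceil (t - x) + 1.
  by rewrite addrAC ceilDrz ?rpred1 // ceil1.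
by apply: eq_bigr => d _; rewrite !cl; congr (_ * _); ring.
Qed.

Lemma floorB01 (R : realType) (t x : R) : 0 <= t < 1 -> 0 <= x < 1 ->
  Num.floor (t - x) = - ((t < x)%R : nat)%:Z.
Proof.
move=> t01 x01; apply: floor_def.
by case: (ltP t x) => h; rewrite ?mulrN1z ?intrD /=; lra.
Qed.

Lemma ceilB01 (R : realType) (t x : R) : 0 <= t < 1 -> 0 <= x < 1 ->
  Num.ceil (t - x) = ((x < t)%R : nat)%:Z.
Proof. by move=> t01 x01; rewrite ceilNfloor opprB floorB01 // opprK. Qed.

Lemma big_fset_single (T : choiceType) (A : {fset T}) (V : nmodType)
    (F : T -> V) (c : T) :
  c \in A -> (forall d, d \in A -> d != c -> F d = 0) ->
  \sum_(d <- A) F d = F c.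
Proof.
move=> cA F0; rewrite (big_fsetD1 c) //= big_seq big1 ?addr0 // => d.
by rewrite !inE => /andP[dc dA]; exact: F0.
Qed.

(** For [t] and [x] in [0, 1), floor minus ceiling of [t - x] is 0 if [t = x] and -1 otherwise; the
    -1 cancels. *)
Lemma arc_label_jump (R : realType) (D : virtual_knot_diagram R) (t : R) :
  0 <= t < 1 ->
  arc_label D t - left_arc_label D t
  = \sum_(d <- crossings D)
      crossing_sign D d * ((t == d.2 : nat)%:Z - (t == d.1 : nat)%:Z).
Proof.
move=> t01; rewrite -sumrB big_seq [RHS]big_seq; apply: eq_bigr => d dD.
have [d1 d2 _ _ _] := crossingsP dD.
rewrite !floorB01 // !ceilB01 // -mulrBr; congr (_ * _).
by case: (ltgtP t d.2); case: (ltgtP t d.1).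
Qed.

Section labels_at_crossing.
Variables (R : realType) (D : virtual_knot_diagram R) (c : R * R).
Hypothesis cD : c \in crossings D.

Lemma arc_label_over :
  arc_label D c.1 = left_arc_label D c.1 - crossing_sign D c.
Proof.
have [c1 c2 nc _ _] := crossingsP cD.
(* Only [c] has an endpoint at [c.1]. *)
have := arc_label_jump D c1; rewrite (big_fset_single cD); last first.
  move=> d dD; rewrite eq_sym => /(crossings_disjoint cD dD)[n11 n12 _ _].
  by rewrite (negPf n11) (negPf n12) mulr0.
by rewrite eqxx (negPf nc) /=; lia.
Qed.

Lemma arc_label_under :
  arc_label D c.2 = left_arc_label D c.2 + crossing_sign D c.
Proof.
have [c1 c2 nc _ _] := crossingsP cD.
have := arc_label_jump D c2; rewrite (big_fset_single cD); last first.
  move=> d dD; rewrite eq_sym => /(crossings_disjoint cD dD)[_ _ n21 n22].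
  by rewrite (negPf n21) (negPf n22) mulr0.
by rewrite eqxx [c.2 == _]eq_sym (negPf nc) /=; lia.
Qed.

(* Only the chords crossing [c] have a nonzero total label jump on the arc from
   [c.1] to [c.2], and these jumps add up to the index of [c]; the additional
   [crossing_sign D c] is the jump at [c.2] itself. *)
Lemma arc_label_over_under :
  arc_label D c.2 = arc_label D c.1 + crossing_sign D c
    + chord_index (gauss_diagram D) (crossing_chord D c).
Proof.
have [c1 c2 nc _ _] := crossingsP cD.
suff : arc_label D c.2 - arc_label D c.1
    - chord_index (gauss_diagram D) (crossing_chord D c) = crossing_sign D c.
  by lia.
rewrite chord_index_sum -!sumrB (big_fset_single cD) => [|d dD].
  (* The term of [c]: it does not cross itself, and exactly one of [c.1 < c.2] and [c.2 < c.1]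
     holds. *)
  rewrite !floorB01 // /arc_intersection /in_arc !ltxx !andbF /=.
  by case: (ltgtP c.1 c.2) nc => //= _ _; ring.
rewrite eq_sym => /(crossings_disjoint cD dD)[n11 n12 n21 n22].
have [d1 d2 _ _ _] := crossingsP dD.
rewrite -!mulrBr !floorB01 // /arc_intersection /in_arc.
rewrite [X in _ * X](_ : _ = 0) ?mulr0 //.
(* In every possible order of the endpoints the floor differences equal the intersection number. *)
move: nc n11 n12 n21 n22.
case: (ltgtP c.1 c.2) => //= ?; case: (ltgtP c.1 d.1) => //= ?;
  case: (ltgtP c.1 d.2) => //= ?; case: (ltgtP c.2 d.1) => //= ?;
  case: (ltgtP c.2 d.2) => //= ?; first [by [] | exfalso; lra].
Qed.

End labels_at_crossing.

Lemma alexander_numbering_arc_label (R : realType) (D : virtual_knot_diagram R) :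
  (forall c, c \in crossings D ->
    chord_index (gauss_diagram D) (crossing_chord D c) = 0) ->
  alexander_numbering D (arc_label D).
Proof.
move=> idx0; split; first exact: arc_label_periodic.
- move=> s t st ncp; rewrite /arc_label big_seq [RHS]big_seq.
  apply: eq_bigr => d dD; have [d1 d2 _ _ _] := crossingsP dD.
  have fl x : 0 <= x < 1 -> (forall r, frac_part r = x -> classical_point D r) ->
      Num.floor (s - x) = Num.floor (t - x).
    move=> x01 xcp; apply/eqP; rewrite eq_le le_floor ?lerB //=.
    rewrite leNgt; apply/negP => lt_fl.
    (* The last translate of [x] up to [t]; it lies beyond [s] because the floors differ. *)
    apply: (ncp (x + (Num.floor (t - x))%:~R)).
      have := floor_itv (s - x); have := floor_itv (t - x).
      have : (Num.floor (s - x) + 1)%:~R <= (Num.floor (t - x))%:~R :> R.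
        by rewrite ler_int; lia.
      lra.
    apply: xcp; rewrite (periodicDint (f := @frac_part R)) ?frac_part_id //.
    exact: frac_part_periodic.
  rewrite (fl d.2) // => [|r rd]; first rewrite (fl d.1) // => r rd.
    exists (d.2 : R); right.
    by rewrite /classical_crossing rd frac_part_id // -surjective_pairing.
  exists (d.1 : R); left.
  by rewrite /classical_crossing rd frac_part_id // -surjective_pairing.
(* [lam] is the label entering the crossing along [a]. *)
- move=> a b cab det_neg; exists (left_arc_label D a).
  have arc_b : arc_label D b = left_arc_label D a /\
     arc_label D a = left_arc_label D a + 1 /\
     left_arc_label D b = left_arc_label D a + 1.
    have pL := periodic_frac_part (@arc_label_periodic R D).
    have pM := periodic_frac_part (@left_arc_label_periodic R D).
    rewrite -(pL a) -(pL b) -(pM a) -(pM b).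
    (* The sign is -1 if [a] is the over-strand and 1 otherwise; either way the label rises by 1
       along [a] and drops by 1 along [b]. Index 0 matches the label leaving along [b] with the one
       entering along [a]. *)
    case: cab => cD; have := idx0 _ cD; have := arc_label_over cD;
      have := arc_label_under cD; have := arc_label_over_under cD => /=.
      have -> : crossing_sign D (frac_part a, frac_part b) = -1.
        by rewrite /crossing_sign /= !velocity_frac_part ltr0_sgz.
      by lia.
    have -> : crossing_sign D (frac_part b, frac_part a) = 1.
      by rewrite /crossing_sign /= !velocity_frac_part gtr0_sgz // det2C oppr_gt0.
    by lia.
  case: arc_b => eb [ea eb']; split.
  + exact: arc_label_near_left.
  + by rewrite -eb; exact: arc_label_near_right.
  + by rewrite -ea; exact: arc_label_near_right.
  + by rewrite -eb'; exact: arc_label_near_left.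
Qed.

(** * The stable projection *)

(** A fixed diagram loses no crossing, so each one passes the evenness test. *)
Lemma manturov_projection_fixed (R : realType) (D : virtual_knot_diagram R) :
  manturov_projection D = D -> forall c, c \in crossings D ->
  chord_index (gauss_diagram D) (crossing_chord D c) = 0.
Proof.
by move=> fixD c; rewrite -{1}fixD mem_crossings_manturov => /andP[_ /eqP].
Qed.

Theorem theorem1p8 (R : realType) (q : nat) (K : virtual_knot_diagram R) :
  (2 <= q)%N ->
  periodic_diagram q K ->
  periodic_diagram q (stable_projection K) /\
  almost_classical (stable_projection K).
Proof.
move=> _ perK; rewrite /stable_projection.
case: (cid _) => n /= fixn; split.
  elim: n {fixn} => //= n IHn; exact: periodic_manturov_projection.
(* By [fixn] every index vanishes at this stage. *)
exists (arc_label (iter n (@manturov_projection R) K)).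
by apply: alexander_numbering_arc_label; exact: manturov_projection_fixed.
Qed.
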